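(* Consider the curved rarefaction wave associated with $u-c$ that emanates from the origin in the generalized Riemann problem, with characteristic coordinates $(\alpha,\beta)$ normalized as described in the context, and let $\Theta(\beta):=\frac{\partial t}{\partial \alpha}(0,\beta)$. Then for $\beta\in[\beta_L,\beta_*]$, $$\frac{\Theta(\beta)}{\Theta(\beta_L)}=\exp\left[\int_{\beta_L}^{\beta}\frac{1}{2c(0,\xi)}\,d\xi\right]=:\Pi(c;\beta,\beta_L).$$ In particular, for polytropic gases with index $\gamma>1$, $$\frac{\Theta(\beta)}{\Theta(\beta_L)}=\left(\frac{c(0,\beta)}{c_L}\right)^{-\frac{1}{2\mu^2}},\qquad \mu^2=\frac{\gamma-1}{\gamma+1}.$$
   Context: Consider the one-dimensional compressible Euler equations for density $\rho$, velocity $u$, pressure $p$: with $\mathbf u=(\rho,\rho u,\rho E)^\top$, $\mathbf f(\mathbf u)=(\rho u,\rho u^2+p,u(\rho E+p))^\top$, $E=\frac{u^2}{2}+e$, the system is $\mathbf u_t+\mathbf f(\mathbf u)_x=\mathbf G(x,\mathbf u)$, where $\mathbf G$ is a source term (external forces or geometrical effects; possibly zero) under which the entropy equation $s_t+us_x=0$ holds in smooth regions. The internal energy $e$, temperature $T$ and entropy $s$ obey the Gibbs relation $T\,ds=de-\frac{p}{\rho^2}\,d\rho$. The sound speed $c>0$ is defined by $c^2=\partial p(\rho,s)/\partial\rho$. A polytropic gas has $p=A(s)\rho^\gamma$, $c^2=\gamma p/\rho$. Generalized Riemann problem (GRP): the initial data at $t=0$ are polynomial (smooth) on each side of $x=0$,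 with one-sided limits $\mathbf u_L,\mathbf u_R$ and one-sided first derivatives $\mathbf u_L',\mathbf u_R'$ at $x=0^\mp$. The solution is assumed piecewise smooth near the origin, away from vacuum. As $t\to0+$ along each ray $x=at$ it tends to the self-similar solution of the classical Riemann problem for $\mathbf u_t+\mathbf f(\mathbf u)_x=0$ with data $\mathbf u_L,\mathbf u_R$. A (curved) rarefaction wave associated with the characteristic field $u-c$ emanates from the origin to the left, adjacent to the left state. Characteristic coordinates: $\alpha(x,t)=$ const and $\beta(x,t)=$ const are the integral curves of $\frac{dx}{dt}=u+c$ and $\frac{dx}{dt}=u-c$, respectively, so that, inside the rarefaction wave, $x=x(\alpha,\beta)$ and $t=t(\alpha,\beta)$ satisfy $$\frac{\partial x}{\partial\alpha}=(u-c)\frac{\partial t}{\partial\alpha},\qquad \frac{\partial x}{\partial\beta}=(u+c)\frac{\partial t}{\partial\beta}.$$ The singular point $(x,t)=(0,0)$ corresponds to $\alpha=0$, with $t(0,\beta)=0$ for all $\beta$, and $\beta$ is normalized as the wave speed at the singular point, $(u-c)(0,\beta)=\beta$. Here $\beta_L=u_L-c_L$ is the speed of the wave head and $\beta_*$ the speed of the wave tail at the origin. Flow variables are regarded as functions of $(\alpha,\beta)$, smooth up to $\alpha=0$ inside the wave; $(0,\beta)$ denotes the value at $\alpha=0$ (the limit at the origin along the $\beta$-characteristic), which for $u,\rho,p,c$ is given by the associated centered Riemann rarefaction. The derivatives $\partial(u\pm c)/\partial\alpha$ are bounded near $\alpha=0$, and $\Theta(\beta)\neq 0$. $c_L$ is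 the sound speed of $\mathbf u_L$. *)

(* Defs.v *)
From Stdlib Require Import Reals Lra.
From Coquelicot Require Import Coquelicot.
Open Scope R_scope.

(** * Calculus on subsets of the line and of the plane

    Derivatives at [x] are taken along [y -> x] with [y] in [D], so that they are
    one-sided at the end points of an interval and on the sides of a rectangle,
    and the usual ones at interior points. *)

Definition is_deriv_within (D : R -> Prop) (f : R -> R) (x l : R) : Prop :=
  filterlim (fun y => (f y - f x) / (y - x)) (within D (locally' x)) (locally l).

Definition partial1 (D : R -> R -> Prop) (f : R -> R -> R) (a b l : R) : Prop :=
  is_deriv_within (fun y => D y b) (fun y => f y b) a l.

Definition partial2 (D : R -> R -> Prop) (f : R -> R -> R) (a b l : R) : Prop :=
  is_deriv_within (fun y => D a y) (fun y => f a y) b l.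

Definition continuous_on1 (D : R -> Prop) (f : R -> R) : Prop :=
  forall x, D x -> filterlim f (within D (locally x)) (locally (f x)).

Definition continuous_on2 (D : R -> R -> Prop) (f : R -> R -> R) : Prop :=
  forall a b, D a b ->
    filterlim (fun z : R * R => f (fst z) (snd z))
      (within (fun z : R * R => D (fst z) (snd z)) (locally (a, b)))
      (locally (f a b)).

Definition C1_on1 (D : R -> Prop) (f : R -> R) : Prop :=
  exists f', (forall x, D x -> is_deriv_within D f x (f' x)) /\ continuous_on1 D f'.

Definition is_gradient_on (D : R -> R -> Prop) (f f1 f2 : R -> R -> R) : Prop :=
  forall a b, D a b -> partial1 D f a b (f1 a b) /\ partial2 D f a b (f2 a b).

Definition C1_on (D : R -> R -> Prop) (f : R -> R -> R) : Prop :=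
  exists f1 f2, is_gradient_on D f f1 f2 /\ continuous_on2 D f1 /\ continuous_on2 D f2.

Definition C2_on (D : R -> R -> Prop) (f : R -> R -> R) : Prop :=
  exists f1 f2, is_gradient_on D f f1 f2 /\ C1_on D f1 /\ C1_on D f2.

(** * Thermodynamics

    All thermodynamic quantities are functions of density and specific entropy. *)

Record eos : Type := Eos {
  eos_dom : R -> R -> Prop;
  energy : R -> R -> R;
  pressure : R -> R -> R;
  temperature : R -> R -> R;
  sound : R -> R -> R
}.

Record is_eos (E : eos) : Prop := {
  eos_open : forall r s, eos_dom E r s -> locally_2d (eos_dom E) r s;
  eos_no_vacuum : forall r s, eos_dom E r s -> 0 < r;
  eos_temperature_pos : forall r s, eos_dom E r s -> 0 < temperature E r s;
  eos_pressure_C1 : C1_on (eos_dom E) (pressure E);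
  eos_temperature_C1 : C1_on (eos_dom E) (temperature E);
  eos_sound_C1 : C1_on (eos_dom E) (sound E);
  (* Gibbs: de = (p / rho^2) d rho + T ds *)
  eos_gibbs : forall r s, eos_dom E r s ->
    differentiable_pt_lim (energy E) r s (pressure E r s / r ^ 2) (temperature E r s);
  eos_sound_pos : forall r s, eos_dom E r s -> 0 < sound E r s;
  eos_sound_def : forall r s, eos_dom E r s ->
    is_derive (fun y => pressure E y s) r (sound E r s ^ 2)
}.

(** [sound E r s ^ 2 = gamma * pressure E r s / r] is then a consequence of
    [eos_sound_def]. *)
Definition polytropic (E : eos) (gamma : R) : Prop :=
  exists A : R -> R, forall r s, eos_dom E r s -> pressure E r s = A s * Rpower r gamma.

(** * The Euler equations *)

Record state : Type := State { rho : R; vel : R; ent : R }.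

Definition admissible (E : eos) (U : state) : Prop := eos_dom E (rho U) (ent U).
Definition press (E : eos) (U : state) : R := pressure E (rho U) (ent U).
Definition csound (E : eos) (U : state) : R := sound E (rho U) (ent U).
Definition total_energy (E : eos) (U : state) : R :=
  vel U ^ 2 / 2 + energy E (rho U) (ent U).

Inductive component : Type := Mass | Momentum | Energy.

Definition conserved (E : eos) (k : component) (U : state) : R :=
  match k with
  | Mass => rho U
  | Momentum => rho U * vel U
  | Energy => rho U * total_energy E U
  end.

Definition flux (E : eos) (k : component) (U : state) : R :=
  match k with
  | Mass => rho U * vel U
  | Momentum => rho U * vel U ^ 2 + press E U
  | Energy => vel U * (rho U * total_energy E U + press E U)
  end.

Definition source : Type := component -> R -> state -> R.
Definition no_source : source := fun _ _ _ => 0.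

Definition state_C1_on1 (D : R -> Prop) (U : R -> state) : Prop :=
  C1_on1 D (fun x => rho (U x)) /\ C1_on1 D (fun x => vel (U x)) /\
  C1_on1 D (fun x => ent (U x)).

Definition state_C1_on (D : R -> R -> Prop) (w : R -> R -> state) : Prop :=
  C1_on D (fun x t => rho (w x t)) /\ C1_on D (fun x t => vel (w x t)) /\
  C1_on D (fun x t => ent (w x t)).

Definition state_lim {T : Type} (F : (T -> Prop) -> Prop) (U : T -> state) (l : state) : Prop :=
  filterlim (fun z => rho (U z)) F (locally (rho l)) /\
  filterlim (fun z => vel (U z)) F (locally (vel l)) /\
  filterlim (fun z => ent (U z)) F (locally (ent l)).

(** Fields over space-time are written [w x t]. *)
Definition smooth_solution_on (E : eos) (G : source) (D : R -> R -> Prop)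
    (w : R -> R -> state) : Prop :=
  (forall x t, D x t -> admissible E (w x t)) /\
  state_C1_on D w /\
  forall k x t, D x t -> exists qt fx,
    is_derive (fun y => conserved E k (w x y)) t qt /\
    is_derive (fun y => flux E k (w y t)) x fx /\
    qt + fx = G k x (w x t).

Definition entropy_preserving (E : eos) (G : source) : Prop :=
  forall (D : R -> R -> Prop) (w : R -> R -> state),
    (forall x t, D x t -> locally_2d D x t) ->
    smooth_solution_on E G D w ->
    forall x t, D x t -> exists st sx,
      is_derive (fun y => ent (w x y)) t st /\
      is_derive (fun y => ent (w y t)) x sx /\
      st + vel (w x t) * sx = 0.

(** * The (generalized) Riemann problem *)

Definition nbhd (r tau : R) (x t : R) : Prop := - r < x < r /\ 0 < t < tau.

Definition off_curves (r tau : R) (n : nat) (X : nat -> R -> R) (x t : R) : Prop :=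
  nbhd r tau x t /\ forall i, (i < n)%nat -> x <> X i t.

(** [w] is a piecewise smooth solution near the origin: it is smooth off the
    curves [x = X i t], [i < n], which issue from the origin, and satisfies the
    Rankine-Hugoniot relations and the entropy inequality
    [(rho s)_t + (rho u s)_x >= 0] across them.  The curves may also carry weak
    discontinuities, i.e. zero jumps.  The data are [wl] for [x < 0] and [wr]
    for [x > 0]; [wl 0] and [wr 0] are their one-sided limits at the origin. *)
Record grp_solution (E : eos) (G : source) (r tau : R) (wl wr : R -> state)
    (n : nat) (X : nat -> R -> R) (w : R -> R -> state) : Prop := {
  grp_size : 0 < r /\ 0 < tau;
  grp_data_admissible :
    (forall x, - r < x <= 0 -> admissible E (wl x)) /\
    (forall x, 0 <= x < r -> admissible E (wr x));
  grp_data_smooth :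
    state_C1_on1 (fun x => - r < x <= 0) wl /\
    state_C1_on1 (fun x => 0 <= x < r) wr;
  grp_data :
    (forall x, - r < x < 0 ->
       state_lim (within (fun z : R * R => 0 < snd z) (locally (x, 0)))
         (fun z => w (fst z) (snd z)) (wl x)) /\
    (forall x, 0 < x < r ->
       state_lim (within (fun z : R * R => 0 < snd z) (locally (x, 0)))
         (fun z => w (fst z) (snd z)) (wr x));
  grp_curves_smooth : forall i, (i < n)%nat -> C1_on1 (fun t => 0 < t < tau) (X i);
  grp_curves_origin : forall i, (i < n)%nat ->
    filterlim (X i) (at_right 0) (locally 0);
  grp_curves_ordered : forall i t, (S i < n)%nat -> 0 < t < tau -> X i t < X (S i) t;
  grp_smooth : smooth_solution_on E G (off_curves r tau n X) w;
  grp_jump : forall i t, (i < n)%nat -> nbhd r tau (X i t) t ->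
    exists (Um Up : state) (sigma : R),
      admissible E Um /\ admissible E Up /\
      state_lim (within (fun z : R * R => fst z < X i (snd z)) (locally (X i t, t)))
        (fun z => w (fst z) (snd z)) Um /\
      state_lim (within (fun z : R * R => X i (snd z) < fst z) (locally (X i t, t)))
        (fun z => w (fst z) (snd z)) Up /\
      is_derive (X i) t sigma /\
      (forall k, flux E k Up - flux E k Um
                 = sigma * (conserved E k Up - conserved E k Um)) /\
      sigma * (rho Up * ent Up - rho Um * ent Um)
        <= rho Up * vel Up * ent Up - rho Um * vel Um * ent Um
}.

(** [V] is the profile of a self-similar solution [V (x / t)]. *)
Definition riemann_solution (E : eos) (UL UR : state) (V : R -> state) : Prop :=
  exists (n : nat) (sigma : nat -> R), forall r tau, 0 < r -> 0 < tau ->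
    grp_solution E no_source r tau (fun _ => UL) (fun _ => UR)
      n (fun i t => sigma i * t) (fun x t => V (x / t)).

Definition tends_along_rays (w : R -> R -> state) (V : R -> state) : Prop :=
  forall a, state_lim (locally a) V (V a) ->
    state_lim (at_right 0) (fun t => w (a * t) t) (V a).

(** The profile [V] contains a centered rarefaction wave of the field [u - c],
    with head speed [bL] and tail speed [bS], adjacent to the left state [UL]. *)
Record centered_rarefaction (E : eos) (UL : state) (bL bS : R) (V : R -> state) : Prop := {
  cr_nonempty : bL < bS;
  cr_head_speed : bL = vel UL - csound E UL;
  cr_left : forall xi, xi <= bL -> V xi = UL;
  cr_continuous : forall xi, bL <= xi <= bS ->
    state_lim (within (fun y => bL <= y <= bS) (locally xi)) V (V xi);
  cr_admissible : forall xi, bL <= xi <= bS -> admissible E (V xi);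
  cr_speed : forall xi, bL <= xi <= bS -> vel (V xi) - csound E (V xi) = xi;
  cr_solution : smooth_solution_on E no_source
    (fun x t => 0 < t /\ bL < x / t < bS) (fun x t => V (x / t))
}.

(** * The curved rarefaction wave in characteristic coordinates *)

(** The range of [(alpha, beta)]. The singularity is the side [alpha = 0]; [alpha]
    runs from [0] to [a1], of either sign, as the orientation of [alpha] is free. *)
Definition char_rect (a1 bL bS : R) (a b : R) : Prop :=
  Rmin 0 a1 <= a <= Rmax 0 a1 /\ bL <= b <= bS.

Definition wave_region (r tau : R) (head tail : R -> R) (x t : R) : Prop :=
  nbhd r tau x t /\ head t <= x <= tail t.

(** [w] is the solution in the [(x, t)] plane, [V] the profile of the associated
    Riemann solution, [x] and [t] the space-time position as functions of
    [(alpha, beta)], and [fl] the flow variables as functions of [(alpha, beta)]. *)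
Record curved_rarefaction (E : eos) (r tau : R) (head tail : R -> R)
    (w : R -> R -> state) (V : R -> state) (a1 bL bS : R)
    (x t : R -> R -> R) (fl : R -> R -> state) : Prop := {
  rw_nondegenerate : a1 <> 0;
  (* no jump across the head and the tail *)
  rw_edges_continuous : forall y s, (y = head s \/ y = tail s) -> nbhd r tau y s ->
    state_lim (locally (y, s)) (fun z : R * R => w (fst z) (snd z)) (w y s);
  rw_position_smooth :
    C2_on (char_rect a1 bL bS) x /\ C2_on (char_rect a1 bL bS) t;
  rw_singular_point : forall b, bL <= b <= bS -> x 0 b = 0 /\ t 0 b = 0;
  rw_in_wave : forall a b, char_rect a1 bL bS a b -> a <> 0 ->
    wave_region r tau head tail (x a b) (t a b);
  rw_injective : forall a b a' b',
    char_rect a1 bL bS a b -> char_rect a1 bL bS a' b' -> a <> 0 -> a' <> 0 ->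
    x a b = x a' b' -> t a b = t a' b' -> a = a' /\ b = b';
  rw_covers : exists delta, 0 < delta /\
    forall y s, wave_region r tau head tail y s -> s < delta ->
      exists a b, char_rect a1 bL bS a b /\ a <> 0 /\ x a b = y /\ t a b = s;
  rw_head : forall a, char_rect a1 bL bS a bL -> a <> 0 -> x a bL = head (t a bL);
  rw_tail : forall a, char_rect a1 bL bS a bS -> a <> 0 -> x a bS = tail (t a bS);
  rw_flow : forall a b, char_rect a1 bL bS a b -> a <> 0 ->
    fl a b = w (x a b) (t a b);
  rw_flow_admissible : forall a b, char_rect a1 bL bS a b -> admissible E (fl a b);
  rw_flow_smooth : state_C1_on (char_rect a1 bL bS) fl;
  rw_characteristics : forall a b, char_rect a1 bL bS a b -> exists ta tb,
    partial1 (char_rect a1 bL bS) t a b ta /\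
    partial2 (char_rect a1 bL bS) t a b tb /\
    partial1 (char_rect a1 bL bS) x a b ((vel (fl a b) - csound E (fl a b)) * ta) /\
    partial2 (char_rect a1 bL bS) x a b ((vel (fl a b) + csound E (fl a b)) * tb);
  rw_normalized : forall b, bL <= b <= bS -> vel (fl 0 b) - csound E (fl 0 b) = b;
  rw_origin : forall b, bL <= b <= bS ->
    vel (fl 0 b) = vel (V b) /\ rho (fl 0 b) = rho (V b) /\
    press E (fl 0 b) = press E (V b) /\ csound E (fl 0 b) = csound E (V b);
  rw_bounded : exists delta M, 0 < delta /\
    forall a b, char_rect a1 bL bS a b -> Rabs a < delta ->
    forall dm dp,
      partial1 (char_rect a1 bL bS)
        (fun a b => vel (fl a b) - csound E (fl a b)) a b dm ->
      partial1 (char_rect a1 bL bS)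
        (fun a b => vel (fl a b) + csound E (fl a b)) a b dp ->
      Rabs dm <= M /\ Rabs dp <= M
}.

Definition Pi_factor (c : R -> R) (b bL : R) : R :=
  exp (RInt (fun xi => 1 / (2 * c xi)) bL b).

Definition mu2 (gamma : R) : R := (gamma - 1) / (gamma + 1).

(* Main.v *)
Require Import Defs.
From Stdlib Require Import Reals Lra.
From Coquelicot Require Import Coquelicot.
Open Scope R_scope.

(** Write [u], [c] for the velocity and the sound speed in the coordinates
    [(a, b)] = (alpha, beta), and indices 1, 2 for the derivatives in [a], [b].
    The characteristic relations are [x1 = (u - c) t1] and [x2 = (u + c) t2].
    Equating the two mixed derivatives of [x] gives
    [(u - c)_b t1 - (u + c)_a t2 = 2 c t12].  At the singular point [t] vanishes
    for every [b], so that [t2 = 0], and [u - c = b], so that [(u - c)_b = 1];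
    since [t1 (0, b) = Theta b], what remains is the linear equation
    [Theta = 2 c Theta'], whose solution is the exponential factor.

    The state is only C1, and its composition with the sound speed is awkward to
    differentiate at the boundary [a = 0], where everything takes place.
    [singular_transport] therefore differentiates neither [u] nor [c] there: it
    computes [x12] from [x1 (0, b) = b Theta b], and [x21] as the limit of
    [x2 / a = (u + c) t2 / a], which takes the continuity of the flow only.  The
    two agree by [mixed_partial], a form of the Schwarz theorem that holds up to
    the sides of a rectangle.  [linear_ode] then integrates the equation.

    For a polytropic gas the integral is explicit because the sound speed is an
    affine function of the wave speed in a centered rarefaction.  In the
    self-similar profile, where [u - c = xi], the balances of mass and momentum
    read [c rho' + rho u' = 0] and [c rho u' + p' = 0]; differentiating
    [c^2 rho = gamma p] along the profile and eliminating [rho'] and [p'] gives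
    [2 c' = (1 - gamma) u'], while [u' = 1 + c'].  Hence [c' = - mu2 gamma]
    ([centered_polytropic_slope]). *)

(** * Limits and derivatives on a closed interval *)

Lemma filterlim_Rplus {T : Type} (F : (T -> Prop) -> Prop) {FF : Filter F}
  (f g : T -> R) (l m : R) :
  filterlim f F (locally l) -> filterlim g F (locally m) ->
  filterlim (fun z => f z + g z) F (locally (l + m)).
Proof.
intros hf hg. exact (filterlim_comp_2 f g Rplus hf hg (filterlim_plus l m)).
Qed.

Lemma filterlim_Rmult {T : Type} (F : (T -> Prop) -> Prop) {FF : Filter F}
  (f g : T -> R) (l m : R) :
  filterlim f F (locally l) -> filterlim g F (locally m) ->
  filterlim (fun z => f z * g z) F (locally (l * m)).
Proof.
intros hf hg. exact (filterlim_comp_2 f g Rmult hf hg (filterlim_mult l m)).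
Qed.

Lemma filterlim_Ropp {T : Type} (F : (T -> Prop) -> Prop) (f : T -> R) (l : R) :
  filterlim f F (locally l) -> filterlim (fun z => - f z) F (locally (- l)).
Proof.
intros hf. exact (filterlim_comp _ _ _ f Ropp _ _ _ hf (filterlim_opp l)).
Qed.

Definition Icc (p q y : R) : Prop := p <= y <= q.

Lemma within_locally'_proper (p q x : R) :
  p < q -> Icc p q x -> ProperFilter (within (Icc p q) (locally' x)).
Proof.
intros hpq hx.
constructor.
- intros P [d hd].
  pose proof (cond_pos d) as dpos.
  assert (exists y, Icc p q y /\ y <> x /\ Rabs (y - x) < d) as [y [hy [hne hb]]].
  { unfold Icc in *.
    destruct (Rlt_dec x q) as [h|h].
    - exists (x + Rmin (d / 2) (q - x)).
      pose proof (Rmin_l (d / 2) (q - x)). pose proof (Rmin_r (d / 2) (q - x)).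
      assert (0 < Rmin (d / 2) (q - x)) by (apply Rmin_glb_lt; lra).
      split; [lra|]. split; [lra|]. rewrite Rabs_right; lra.
    - exists (x - Rmin (d / 2) (x - p)).
      pose proof (Rmin_l (d / 2) (x - p)). pose proof (Rmin_r (d / 2) (x - p)).
      assert (0 < Rmin (d / 2) (x - p)) by (apply Rmin_glb_lt; lra).
      split; [lra|]. split; [lra|]. rewrite Rabs_left; lra. }
  exists y. exact (hd y hb hne hy).
- apply within_filter, locally'_filter.
Qed.

(** The eps-delta form is easier to restrict to smaller domains. *)
Lemma is_deriv_within_eps (D : R -> Prop) (f : R -> R) (x l : R) :
  is_deriv_within D f x l <->
  forall eps, 0 < eps -> exists d, 0 < d /\ forall y, D y -> y <> x ->
    Rabs (y - x) < d -> Rabs ((f y - f x) / (y - x) - l) < eps.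
Proof.
split.
- intros H eps he.
  destruct (proj1 (filterlim_locally _ _) H (mkposreal eps he)) as [d hd].
  exists d; split; [apply cond_pos|].
  intros y hD hne hy. exact (hd y hy hne hD).
- intros H. apply filterlim_locally. intros eps.
  destruct (H eps (cond_pos eps)) as [d [hd h]].
  exists (mkposreal d hd). intros y hy hne hD. exact (h y hD hne hy).
Qed.

Lemma is_deriv_within_subset (D D' : R -> Prop) (f : R -> R) (x l : R) :
  (forall y, D' y -> D y) -> is_deriv_within D f x l -> is_deriv_within D' f x l.
Proof.
rewrite !is_deriv_within_eps. intros hs H eps he.
destruct (H eps he) as [d [hd h]]. exists d; split; auto.
Qed.

Lemma is_deriv_within_ext (D : R -> Prop) (f g : R -> R) (x l : R) :
  D x -> (forall y, D y -> f y = g y) ->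
  is_deriv_within D f x l -> is_deriv_within D g x l.
Proof.
rewrite !is_deriv_within_eps. intros hx he H eps heps.
destruct (H eps heps) as [d [hd h]]. exists d. split; [exact hd|].
intros y hy. rewrite <- !he by assumption. now apply h.
Qed.

Lemma is_deriv_within_unique (p q : R) (f : R -> R) (x l l' : R) :
  p < q -> Icc p q x ->
  is_deriv_within (Icc p q) f x l -> is_deriv_within (Icc p q) f x l' -> l = l'.
Proof.
intros hpq hx H H'.
pose proof (within_locally'_proper p q x hpq hx) as FP.
exact (filterlim_locally_unique (F := within (Icc p q) (locally' x)) _ l l' H H').
Qed.

Lemma is_deriv_within_minus (D : R -> Prop) (f g : R -> R) (x l m : R) :
  is_deriv_within D f x l -> is_deriv_within D g x m ->
  is_deriv_within D (fun y => f y - g y) x (l - m).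
Proof.
rewrite !is_deriv_within_eps. intros Hf Hg eps he.
destruct (Hf (eps / 2)) as [d [hd h]]; [lra|].
destruct (Hg (eps / 2)) as [d' [hd' h']]; [lra|].
exists (Rmin d d'). split; [now apply Rmin_glb_lt|].
intros y hD hne hy.
specialize (h y hD hne (Rlt_le_trans _ _ _ hy (Rmin_l _ _))).
specialize (h' y hD hne (Rlt_le_trans _ _ _ hy (Rmin_r _ _))).
replace ((f y - g y - (f x - g x)) / (y - x) - (l - m))
  with (((f y - f x) / (y - x) - l) - ((g y - g x) / (y - x) - m))
  by (field; lra).
unfold Rminus at 1. eapply Rle_lt_trans; [apply Rabs_triang|].
rewrite Rabs_Ropp. lra.
Qed.

Lemma is_deriv_within_const (D : R -> Prop) (f : R -> R) (x k : R) :
  f x = k -> (forall y, D y -> f y = k) -> is_deriv_within D f x 0.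
Proof.
rewrite is_deriv_within_eps. intros hx H eps he.
exists 1. split; [lra|]. intros y hD hne _.
rewrite hx, (H y hD).
replace ((k - k) / (y - x) - 0) with 0 by (field; lra).
now rewrite Rabs_R0.
Qed.

Lemma is_deriv_within_continuous (D : R -> Prop) (f : R -> R) (x l : R) :
  is_deriv_within D f x l -> filterlim f (within D (locally x)) (locally (f x)).
Proof.
rewrite is_deriv_within_eps. intros H.
apply filterlim_locally. intros eps.
destruct (H 1 Rlt_0_1) as [d [hd h]].
pose proof (cond_pos eps) as he.
assert (hm : 0 < Rabs l + 1) by (pose proof (Rabs_pos l); lra).
assert (hk : 0 < eps / (Rabs l + 1)) by now apply Rdiv_lt_0_compat.
exists (mkposreal _ (Rmin_glb_lt _ _ _ hd hk)).
intros y hy hD. change (Rabs (f y - f x) < eps).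
change (Rabs (y - x) < Rmin d (eps / (Rabs l + 1))) in hy.
pose proof (Rlt_le_trans _ _ _ hy (Rmin_l _ _)) as h1.
pose proof (Rlt_le_trans _ _ _ hy (Rmin_r _ _)) as h2.
destruct (Req_dec y x) as [->|hne].
- rewrite Rminus_diag. now rewrite Rabs_R0.
- specialize (h y hD hne h1).
  replace (f y - f x) with ((f y - f x) / (y - x) * (y - x)) by (field; lra).
  rewrite Rabs_mult.
  assert (Rabs ((f y - f x) / (y - x)) <= Rabs l + 1).
  { replace ((f y - f x) / (y - x)) with (((f y - f x) / (y - x) - l) + l) by ring.
    eapply Rle_trans; [apply Rabs_triang|]. lra. }
  apply Rle_lt_trans with ((Rabs l + 1) * Rabs (y - x)).
  + apply Rmult_le_compat_r; [apply Rabs_pos|assumption].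
  + apply Rmult_lt_reg_r with (/ (Rabs l + 1)); [now apply Rinv_0_lt_compat|].
    replace ((Rabs l + 1) * Rabs (y - x) * / (Rabs l + 1)) with (Rabs (y - x))
      by (field; lra).
    exact h2.
Qed.

(** The form in which continuity meets difference quotients, which exclude the
    base point. *)
Lemma filterlim_within_punctured (D : R -> Prop) (f : R -> R) (x l : R) :
  filterlim f (within D (locally x)) (locally l) ->
  filterlim f (within D (locally' x)) (locally l).
Proof.
apply filterlim_filter_le_1. intros P [d hd].
exists d. intros y hy _ hD. exact (hd y hy hD).
Qed.

Lemma is_deriv_within_interior (D : R -> Prop) (f : R -> R) (x l : R) :
  locally x D -> is_deriv_within D f x l -> is_derive f x l.
Proof.
rewrite is_deriv_within_eps. intros [d0 hd0] H.
apply is_derive_Reals. intros eps he.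
destruct (H eps he) as [d [hd h]].
exists (mkposreal _ (Rmin_glb_lt _ _ _ (cond_pos d0) hd)).
intros k hk hlt. simpl in hlt.
specialize (h (x + k)).
replace (x + k - x) with k in h by ring.
apply h.
- apply hd0. change (Rabs (x + k - x) < d0). replace (x + k - x) with k by ring.
  eapply Rlt_le_trans; [exact hlt|apply Rmin_l].
- lra.
- eapply Rlt_le_trans; [exact hlt|apply Rmin_r].
Qed.

Lemma is_derive_value_unique (f : R -> R) (x l m : R) :
  is_derive f x l -> is_derive f x m -> l = m.
Proof.
intros hl hm. apply is_derive_unique in hl, hm. congruence.
Qed.

Lemma locally_Icc (p q x : R) : p < x < q -> locally x (Icc p q).
Proof.
intros [h1 h2].
apply filter_and.
- apply (filter_imp (fun y => p < y)); [intros; lra|now apply open_gt].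
- apply (filter_imp (fun y => y < q)); [intros; lra|now apply open_lt].
Qed.

(** [f] composed with the retraction on [[p, q]] extends [f] continuously to the
    whole line; theorems that require two-sided continuity at the end points then
    apply to it. *)
Definition clamp (p q y : R) : R := Rmax p (Rmin q y).

Lemma clamp_Icc (p q y : R) : p <= q -> Icc p q (clamp p q y).
Proof.
intros h. unfold Icc, clamp. split; [apply Rmax_l|].
apply Rmax_lub; [exact h|apply Rmin_l].
Qed.

Lemma clamp_id (p q y : R) : Icc p q y -> clamp p q y = y.
Proof.
intros [h1 h2]. unfold clamp. rewrite Rmin_right by assumption.
now rewrite Rmax_right.
Qed.

Lemma clamp_lipschitz (p q y z : R) :
  p <= q -> Rabs (clamp p q y - clamp p q z) <= Rabs (y - z).
Proof.
intros h. unfold clamp, Rmax, Rmin, Rabs.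
repeat destruct Rle_dec; repeat destruct Rcase_abs; lra.
Qed.

Lemma continuous_clamp (p q : R) (f : R -> R) (x : R) :
  p <= q -> continuous_on1 (Icc p q) f -> continuous (fun y => f (clamp p q y)) x.
Proof.
intros hpq hf.
apply (filterlim_comp _ _ _ (clamp p q) f _
         (within (Icc p q) (locally (clamp p q x)))).
- intros P [d hd]. exists d. intros y hy.
  apply hd.
  + change (Rabs (clamp p q y - clamp p q x) < d).
    eapply Rle_lt_trans; [now apply clamp_lipschitz|exact hy].
  + now apply clamp_Icc.
- apply hf. now apply clamp_Icc.
Qed.

Lemma mvt_closed (p q : R) (f f' : R -> R) (a b : R) :
  continuous_on1 (Icc p q) f ->
  (forall y, p < y < q -> is_derive f y (f' y)) ->
  Icc p q a -> Icc p q b ->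
  exists c, Rmin a b <= c <= Rmax a b /\ f b - f a = f' c * (b - a).
Proof.
intros hc hd ha hb.
assert (hpq : p <= q) by (unfold Icc in *; lra).
assert (hmin : p <= Rmin a b) by (apply Rmin_glb; [apply ha|apply hb]).
assert (hmax : Rmax a b <= q) by (apply Rmax_lub; [apply ha|apply hb]).
destruct (MVT_gen (fun y => f (clamp p q y)) a b f') as [c [hcc he]].
- intros y hy.
  assert (hy' : p < y < q) by lra.
  apply (is_derive_ext_loc f); [|now apply hd].
  apply (filter_imp (Icc p q)); [|now apply locally_Icc].
  intros z hz. now rewrite clamp_id.
- intros y _. apply continuity_pt_filterlim. now apply continuous_clamp.
- exists c. split; [exact hcc|].
  now rewrite !clamp_id in he.
Qed.

Lemma mvt_within (p q : R) (f f' : R -> R) (a b : R) :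
  (forall y, Icc p q y -> is_deriv_within (Icc p q) f y (f' y)) ->
  Icc p q a -> Icc p q b ->
  exists c, Rmin a b <= c <= Rmax a b /\ f b - f a = f' c * (b - a).
Proof.
intros hd. apply mvt_closed.
- intros y hy. exact (is_deriv_within_continuous _ _ _ _ (hd y hy)).
- intros y hy. apply (is_deriv_within_interior (Icc p q)).
  + now apply locally_Icc.
  + apply hd. unfold Icc. lra.
Qed.

(** * Mixed partial derivatives up to the boundary of a rectangle *)

(** [char_rect a1 bL bS] is the case [p = Rmin 0 a1], [q = Rmax 0 a1], with the
    orientation of the first coordinate left out of sight. *)
Definition rect (p q r s a b : R) : Prop := p <= a <= q /\ r <= b <= s.

Lemma partial1_rect (p q r s : R) (f : R -> R -> R) (a b l : R) :
  Icc r s b ->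
  partial1 (rect p q r s) f a b l <-> is_deriv_within (Icc p q) (fun y => f y b) a l.
Proof.
intros hb. split; apply is_deriv_within_subset; unfold rect, Icc in *; tauto.
Qed.

Lemma partial2_rect (p q r s : R) (f : R -> R -> R) (a b l : R) :
  Icc p q a ->
  partial2 (rect p q r s) f a b l <-> is_deriv_within (Icc r s) (fun y => f a y) b l.
Proof.
intros ha. split; apply is_deriv_within_subset; unfold rect, Icc in *; tauto.
Qed.

Lemma between_dist (a b c d : R) :
  Rmin a b <= c <= Rmax a b -> Rabs (b - a) < d -> Rabs (c - a) < d.
Proof.
unfold Rmin, Rmax, Rabs.
repeat destruct Rle_dec; repeat destruct Rcase_abs; lra.
Qed.

Lemma between_Icc (p q a b c : R) :
  Rmin a b <= c <= Rmax a b -> Icc p q a -> Icc p q b -> Icc p q c.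
Proof.
unfold Rmin, Rmax, Icc. repeat destruct Rle_dec; lra.
Qed.

(** Peano's form of the Schwarz theorem: the existence of the derivative of [f1]
    along the second coordinate is part of the conclusion.  The second difference
    of [f] over a small rectangle with corner [(a, b)] is, by two applications of
    the mean value theorem, the area times a value of [f21] near [(a, b)]; letting
    the first side tend to zero turns it into an increment of [f1].  Only
    rectangles inside the domain occur, so [(a, b)] may lie on a side. *)
Lemma mixed_partial (p q r s : R) (f f1 f2 f21 : R -> R -> R) :
  p < q ->
  is_gradient_on (rect p q r s) f f1 f2 ->
  (forall a b, rect p q r s a b -> partial1 (rect p q r s) f2 a b (f21 a b)) ->
  continuous_on2 (rect p q r s) f21 ->
  forall a b, rect p q r s a b -> partial2 (rect p q r s) f1 a b (f21 a b).
Proof.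
intros hpq hgrad h21 hcont a b hab.
destruct hab as [ha hb].
apply partial2_rect; [exact ha|].
apply is_deriv_within_eps. intros eps he.
assert (he2 : 0 < eps / 2) by lra.
destruct (proj1 (filterlim_locally _ _) (hcont a b (conj ha hb)) (mkposreal _ he2))
  as [d hd].
exists d. split; [apply cond_pos|].
intros b' hb' hne hdist.
assert (hk : 0 < Rabs (b' - b)) by (apply Rabs_pos_lt; lra).
pose proof (is_deriv_within_minus _ _ _ _ _ _
  (proj1 (partial1_rect _ _ _ _ _ _ _ _ hb') (proj1 (hgrad a b' (conj ha hb'))))
  (proj1 (partial1_rect _ _ _ _ _ _ _ _ hb) (proj1 (hgrad a b (conj ha hb))))) as g.
apply is_deriv_within_eps with (eps := eps / 2 * Rabs (b' - b)) in g;
  [|now apply Rmult_lt_0_compat].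
destruct g as [d' [hd' hg]].
(* [b'] is fixed; [a'] is taken so close to [a] that the difference quotient
   of [f (., b') - f (., b)] is within [eps / 2 * |b' - b|] of its limit. *)
assert (hex : exists a', Icc p q a' /\ a' <> a /\ Rabs (a' - a) < Rmin d d').
{ pose proof (within_locally'_proper p q a hpq ha) as FP.
  apply (filter_ex (F := within (Icc p q) (locally' a))).
  exists (mkposreal _ (Rmin_glb_lt _ _ _ (cond_pos d) hd')).
  intros y hy hny hI. split; [exact hI|]. split; [exact hny|exact hy]. }
destruct hex as [a' [ha' [hane hadist]]].
specialize (hg a' ha' hane (Rlt_le_trans _ _ _ hadist (Rmin_r _ _))).
destruct (mvt_within r s (fun y => f a' y - f a y) (fun y => f2 a' y - f2 a y) b b')
  as [eta [heta e1]]; try assumption.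
{ intros y hy. apply is_deriv_within_minus.
  - apply (partial2_rect p q); [exact ha'|]. exact (proj2 (hgrad a' y (conj ha' hy))).
  - apply (partial2_rect p q); [exact ha|]. exact (proj2 (hgrad a y (conj ha hy))). }
assert (hetaI : Icc r s eta) by now apply between_Icc with b b'.
destruct (mvt_within p q (fun y => f2 y eta) (fun y => f21 y eta) a a')
  as [xi [hxi e2]]; try assumption.
{ intros y hy. apply (partial1_rect p q r s); [exact hetaI|].
  exact (h21 y eta (conj hy hetaI)). }
assert (hxiI : Icc p q xi) by now apply between_Icc with a a'.
assert (hnear : Rabs (f21 xi eta - f21 a b) < eps / 2).
{ apply (hd (xi, eta)); [split|split; assumption].
  - apply (between_dist a a'); [exact hxi|].
    eapply Rlt_le_trans; [exact hadist|apply Rmin_l].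
  - now apply (between_dist b b'). }
simpl in e1, e2. rewrite e2 in e1.
replace ((f a' b' - f a' b - (f a b' - f a b)) / (a' - a))
  with (f21 xi eta * (b' - b)) in hg.
2: { replace (f a' b' - f a' b - (f a b' - f a b))
       with (f a' b' - f a b' - (f a' b - f a b)) by ring.
     rewrite e1. field. lra. }
replace (f21 xi eta * (b' - b) - (f1 a b' - f1 a b))
  with ((f21 xi eta - (f1 a b' - f1 a b) / (b' - b)) * (b' - b)) in hg by (field; lra).
rewrite Rabs_mult in hg. apply Rmult_lt_reg_r in hg; [|exact hk].
replace ((f1 a b' - f1 a b) / (b' - b) - f21 a b)
  with ((f21 xi eta - f21 a b) - (f21 xi eta - (f1 a b' - f1 a b) / (b' - b))) by ring.
unfold Rminus at 1. eapply Rle_lt_trans; [apply Rabs_triang|].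
rewrite Rabs_Ropp. lra.
Qed.

(** * The transport equation at the singular point *)

(** [y exp (- P)], with [P] a primitive of [h], has zero derivative.  The
    primitive is that of the clamped [h], so as to be differentiable on the whole
    line. *)
Lemma linear_ode (p q : R) (h y : R -> R) :
  continuous_on1 (Icc p q) h -> continuous_on1 (Icc p q) y ->
  (forall b, p < b < q -> is_derive y b (h b * y b)) ->
  forall b, Icc p q b -> y b = y p * exp (RInt h p b).
Proof.
intros hh hy hd b hb.
assert (hpq : p <= q) by (unfold Icc in *; lra).
set (H z := h (clamp p q z)).
assert (Hc : forall z, continuous H z) by (intros z; now apply continuous_clamp).
set (P := (fun z => RInt H p z) : R -> R).
assert (hP : forall z, is_derive P z (H z)).
{ intros z. apply (is_derive_RInt H P p); [|apply Hc].
  apply filter_forall. intros u. apply (RInt_correct H p u).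
  apply (ex_RInt_continuous H). intros; apply Hc. }
assert (hPexp : forall z, is_derive (fun z => exp (- P z)) z (- H z * exp (- P z))).
{ intros z. apply (is_derive_comp exp (fun z => - P z)).
  - apply is_derive_exp.
  - apply (is_derive_opp P). apply hP. }
assert (hI : RInt h p b = P b).
{ apply RInt_ext. intros z. unfold Icc in hb.
  rewrite Rmin_left, Rmax_right by lra. intros hz.
  unfold H. rewrite clamp_id; [reflexivity|unfold Icc; lra]. }
destruct (mvt_closed p q (fun z => y z * exp (- P z)) (fun _ => 0) p b) as [c [_ e]];
  [| |unfold Icc; lra|exact hb|].
- intros z hz.
  apply filterlim_Rmult; [typeclasses eauto| |].
  + now apply hy.
  + apply (filterlim_filter_le_1 _ (filter_le_within (F := locally z) (Icc p q))).
    apply (ex_derive_continuous (fun z => exp (- P z))). eexists. apply hPexp.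
- intros z hz.
  replace 0 with (h z * y z * exp (- P z) + y z * (- H z * exp (- P z))).
  + apply (is_derive_mult y (fun z => exp (- P z))); [now apply hd|apply hPexp|].
    intros; apply Rmult_comm.
  + unfold H. rewrite clamp_id by (unfold Icc; lra). ring.
- rewrite hI.
  assert (e0 : P p = 0) by exact (RInt_point p H).
  rewrite e0, Ropp_0, exp_0 in e.
  replace (y p) with (y b * exp (- P b)) by lra.
  rewrite Rmult_assoc, <- exp_plus.
  replace (- P b + P b) with 0 by ring. rewrite exp_0. ring.
Qed.

(** The equation [2 c Theta' = Theta].  Its coefficient is found by letting
    [a] tend to 0 in [x2 / a = (u + c) t2 / a], where [c] is eliminated in favour of
    [x1 = (u - c) t1]; this is why continuity is asked of [u] alone. *)
Lemma singular_transport (p q r s : R) (x t u c : R -> R -> R) (Theta : R -> R) :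
  p < q -> r < s -> Icc p q 0 ->
  C2_on (rect p q r s) x -> C2_on (rect p q r s) t ->
  (forall b, Icc r s b -> x 0 b = 0 /\ t 0 b = 0) ->
  (forall a b, rect p q r s a b -> exists ta tb,
    partial1 (rect p q r s) t a b ta /\
    partial2 (rect p q r s) t a b tb /\
    partial1 (rect p q r s) x a b ((u a b - c a b) * ta) /\
    partial2 (rect p q r s) x a b ((u a b + c a b) * tb)) ->
  (forall b, Icc r s b -> u 0 b - c 0 b = b) ->
  (forall b, Icc r s b ->
    filterlim (fun a => u a b) (within (Icc p q) (locally 0)) (locally (u 0 b))) ->
  (forall b, Icc r s b -> c 0 b <> 0) ->
  (forall b, Icc r s b -> partial1 (rect p q r s) t 0 b (Theta b)) ->
  (forall b, Icc r s b -> Theta b <> 0) ->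
  forall b, Icc r s b ->
    is_deriv_within (Icc r s) Theta b (1 / (2 * c 0 b) * Theta b).
Proof.
intros hpq hrs h0 [x1 [x2 [gx [Cx1 Cx2]]]] [t1 [t2 [gt [Ct1 Ct2]]]]
  hsing hchar hnorm hu hc hTh hTh0.
destruct Cx2 as [x21 [x22 [gx2 [cx21 _]]]].
destruct Ct2 as [t21 [t22 [gt2 [ct21 _]]]].
assert (char : forall a b, Icc p q a -> Icc r s b ->
  x1 a b = (u a b - c a b) * t1 a b /\ x2 a b = (u a b + c a b) * t2 a b).
{ intros a b ha hb.
  destruct (hchar a b (conj ha hb)) as [ta [tb [e1 [e2 [e3 e4]]]]].
  destruct (gx a b (conj ha hb)) as [g1 g2].
  destruct (gt a b (conj ha hb)) as [g3 g4].
  apply partial1_rect in e1, e3, g1, g3; try exact hb.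
  apply partial2_rect in e2, e4, g2, g4; try exact ha.
  rewrite (is_deriv_within_unique _ _ _ _ _ _ hpq ha g3 e1).
  rewrite (is_deriv_within_unique _ _ _ _ _ _ hrs hb g4 e2).
  split; [now apply (is_deriv_within_unique _ _ _ _ _ _ hpq ha g1)
         |now apply (is_deriv_within_unique _ _ _ _ _ _ hrs hb g2)]. }
assert (Theta_t1 : forall b, Icc r s b -> Theta b = t1 0 b).
{ intros b hb. apply (is_deriv_within_unique _ _ _ _ _ _ hpq h0
    (proj1 (partial1_rect _ _ _ _ _ _ _ _ hb) (hTh b hb))).
  apply (partial1_rect p q r s); [exact hb|]. exact (proj1 (gt 0 b (conj h0 hb))). }
assert (zero2 : forall b, Icc r s b -> x2 0 b = 0 /\ t2 0 b = 0).
{ intros b hb. split; apply (is_deriv_within_unique r s (fun _ => 0) b); try assumption;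
  try (apply (is_deriv_within_const _ _ _ 0); reflexivity).
  - apply (is_deriv_within_ext _ (x 0)); [exact hb|intros y hy; now apply hsing|].
    apply (partial2_rect p q); [exact h0|]. exact (proj2 (gx 0 b (conj h0 hb))).
  - apply (is_deriv_within_ext _ (t 0)); [exact hb|intros y hy; now apply hsing|].
    apply (partial2_rect p q); [exact h0|]. exact (proj2 (gt 0 b (conj h0 hb))). }
intros b hb.
assert (dTheta : is_deriv_within (Icc r s) Theta b (t21 0 b)).
{ apply (is_deriv_within_ext _ (t1 0)); [exact hb|intros; symmetry; now apply Theta_t1|].
  apply (partial2_rect p q); [exact h0|].
  apply (mixed_partial p q r s t t1 t2); try assumption; [|now split].
  intros; now apply gt2. }
assert (dx1 : is_deriv_within (Icc r s) (fun y => y * Theta y) b (x21 0 b)).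
{ apply (is_deriv_within_ext _ (x1 0)); [exact hb| |].
  - intros y hy. rewrite (proj1 (char 0 y h0 hy)), hnorm, Theta_t1; trivial.
  - apply (partial2_rect p q); [exact h0|].
    apply (mixed_partial p q r s x x1 x2); try assumption; [|now split].
    intros; now apply gx2. }
(* the derivative of [b * Theta b], by the product rule *)
assert (eq1 : x21 0 b = Theta b + b * t21 0 b).
{ apply (is_deriv_within_unique _ _ _ _ _ _ hrs hb dx1).
  apply (filterlim_ext_loc
    (fun y => Theta y + b * ((Theta y - Theta b) / (y - b)))).
  - exists (mkposreal 1 Rlt_0_1). intros y _ hy _. field. lra.
  - apply filterlim_Rplus; [typeclasses eauto| |].
    + apply filterlim_within_punctured. exact (is_deriv_within_continuous _ _ _ _ dTheta).
    + apply filterlim_Rmult; [typeclasses eauto| |exact dTheta].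
      apply filterlim_const. }
(* [x2 = (u + c) t2] multiplied by [t1] reads [t1 x2 = (2 u t1 - x1) t2]; both sides
   vanish on the singular side, and [eq2] is the limit of their quotients by [a].
   The product with [t1] trades [c] for [x1], whose limit is known. *)
assert (eq2 : t1 0 b * x21 0 b = (2 * u 0 b * t1 0 b - x1 0 b) * t21 0 b).
{ set (F := within (Icc p q) (locally' 0)).
  pose proof (within_locally'_proper p q 0 hpq h0) as FP.
  assert (cont1 : forall f f' l, partial1 (rect p q r s) f 0 b l -> f' = f 0 b ->
     filterlim (fun a => f a b) F (locally f')).
  { intros f f' l hf ->. apply filterlim_within_punctured.
    apply (is_deriv_within_continuous _ (fun a => f a b) 0 l).
    now apply (partial1_rect p q r s). }
  destruct Cx1 as [x11 [x12 [gx1 _]]]. destruct Ct1 as [t11 [t12 [gt1 _]]].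
  pose proof (cont1 x1 _ _ (proj1 (gx1 0 b (conj h0 hb))) eq_refl) as lx1.
  pose proof (cont1 t1 _ _ (proj1 (gt1 0 b (conj h0 hb))) eq_refl) as lt1.
  pose proof (filterlim_within_punctured _ _ _ _ (hu b hb)) as lu.
  pose proof (proj1 (partial1_rect p q r s _ _ _ _ hb) (proj1 (gx2 0 b (conj h0 hb)))) as lx2.
  pose proof (proj1 (partial1_rect p q r s _ _ _ _ hb) (proj1 (gt2 0 b (conj h0 hb)))) as lt2.
  unfold is_deriv_within in lx2, lt2. fold F in lx2, lt2, lu.
  apply (filterlim_locally_unique (F := F)
    (fun a => t1 a b * ((x2 a b - x2 0 b) / (a - 0)))).
  - now apply filterlim_Rmult; [typeclasses eauto| |].
  - apply (filterlim_ext_loc (fun a =>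
      (2 * u a b * t1 a b - x1 a b) * ((t2 a b - t2 0 b) / (a - 0)))).
    + exists (mkposreal 1 Rlt_0_1). intros a _ ha haI.
      destruct (char a b haI hb) as [-> ->]. destruct (zero2 b hb) as [-> ->].
      field. lra.
    + apply filterlim_Rmult; [typeclasses eauto| |exact lt2].
      apply filterlim_Rplus; [typeclasses eauto| |now apply filterlim_Ropp].
      apply filterlim_Rmult; [typeclasses eauto| |exact lt1].
      apply filterlim_Rmult; [typeclasses eauto|apply filterlim_const|exact lu]. }
rewrite (proj1 (char 0 b h0 hb)), hnorm, <- Theta_t1, eq1 in eq2 by assumption.
assert (eq3 : Theta b = 2 * c 0 b * t21 0 b).
{ specialize (hnorm b hb). apply Rmult_eq_reg_l with (Theta b); [|now apply hTh0].
  replace (u 0 b) with (b + c 0 b) in eq2 by lra. nra. }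
rewrite eq3. replace (1 / (2 * c 0 b) * (2 * c 0 b * t21 0 b)) with (t21 0 b).
- exact dTheta.
- field. now apply hc.
Qed.

(** * The sound speed in a centered rarefaction of a polytropic gas *)

(** [c^2 = gamma p / rho], obtained by differentiating [A s * rho ^ gamma] in the
    density at fixed entropy. *)
Lemma polytropic_sound (E : eos) (gamma : R) :
  is_eos E -> polytropic E gamma ->
  forall r s, eos_dom E r s -> sound E r s ^ 2 * r = gamma * pressure E r s.
Proof.
intros hE [A hA] r s hrs.
pose proof (eos_no_vacuum E hE r s hrs) as hr.
assert (hd : is_derive (fun y => pressure E y s) r (A s * (gamma * Rpower r (gamma - 1)))).
{ apply (is_derive_ext_loc (fun y => A s * Rpower y gamma)).
  - destruct (eos_open E hE r s hrs) as [d hd].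
    exists d. intros y hy. symmetry. apply hA. apply hd; [exact hy|].
    rewrite Rminus_diag, Rabs_R0. apply cond_pos.
  - apply is_derive_scal. apply is_derive_Reals. now apply derivable_pt_lim_power. }
rewrite (is_derive_value_unique _ _ _ _ (eos_sound_def E hE r s hrs) hd), (hA r s hrs).
replace (Rpower r gamma) with (Rpower r (gamma - 1) * r); [ring|].
rewrite <- (Rpower_1 r) at 2 by exact hr.
rewrite <- Rpower_plus. f_equal. ring.
Qed.

(** On the line [t = 1] the field [g (x / t)] is the profile itself. *)
Lemma self_similar_derive (bL bS : R) (g : R -> R) (xi : R) :
  bL < xi < bS ->
  C1_on (fun x t => 0 < t /\ bL < x / t < bS) (fun x t => g (x / t)) ->
  exists l, is_derive g xi l.
Proof.
intros hxi [f1 [f2 [hg _]]].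
exists (f1 xi 1).
assert (hD : 0 < 1 /\ bL < xi / 1 < bS) by (rewrite Rdiv_1_r; lra).
apply (is_derive_ext (fun y => g (y / 1))); [intros y; now rewrite Rdiv_1_r|].
apply (is_deriv_within_interior (fun y => 0 < 1 /\ bL < y / 1 < bS)).
- apply (filter_imp (fun y => bL < y /\ y < bS)).
  + intros y hy. rewrite Rdiv_1_r. lra.
  + apply filter_and; [now apply open_gt|now apply open_lt].
- exact (proj1 (hg xi 1 hD)).
Qed.

(** A conservation law for a field of [x / t] becomes [f' = xi q'], as the time
    derivative at [t = 1] is [- xi q']. *)
Lemma self_similar_balance (q f : R -> R) (xi q' qt fx : R) :
  is_derive q xi q' ->
  is_derive (fun y => q (xi / y)) 1 qt ->
  is_derive (fun y => f (y / 1)) xi fx ->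
  qt + fx = 0 -> is_derive f xi (xi * q').
Proof.
intros hq hqt hf e.
assert (hinv : is_derive (fun y => xi / y) 1 (- xi)).
{ auto_derive; [lra|field]. }
assert (hc : is_derive (fun y => q (xi / y)) 1 (- xi * q')).
{ apply (is_derive_comp q (fun y => xi / y)); [now rewrite Rdiv_1_r|exact hinv]. }
apply (is_derive_ext (fun y => f (y / 1))); [intros y; now rewrite Rdiv_1_r|].
replace (xi * q') with fx; [exact hf|].
pose proof (is_derive_value_unique _ _ _ _ hqt hc). lra.
Qed.

(** Mass, momentum and the derivative of [c^2 rho = gamma p] along the profile are
    three linear relations between [rho'], [u'] and [p'], with [c' = u' - 1]. *)
Lemma centered_polytropic_slope (E : eos) (UL : state) (bL bS gamma : R) (V : R -> state) :
  is_eos E -> polytropic E gamma -> 1 < gamma ->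
  centered_rarefaction E UL bL bS V ->
  forall xi, bL < xi < bS ->
    is_derive (fun y => csound E (V y)) xi (- mu2 gamma).
Proof.
intros hE hpoly hgam hcr xi hxi.
destruct (cr_solution _ _ _ _ _ hcr) as [_ [[Crho [Cvel _]] hcons]].
destruct (self_similar_derive bL bS (fun y => rho (V y)) xi hxi Crho) as [r' hr].
destruct (self_similar_derive bL bS (fun y => vel (V y)) xi hxi Cvel) as [u' hu].
assert (hD : 0 < 1 /\ bL < xi / 1 < bS) by (rewrite Rdiv_1_r; lra).
destruct (hcons Mass xi 1 hD) as [mt [mx [hmt [hmx em]]]].
destruct (hcons Momentum xi 1 hD) as [nt [nx [hnt [hnx en]]]].
clear hcons.
pose proof (self_similar_balance (fun y => rho (V y)) (fun y => rho (V y) * vel (V y))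
  _ _ _ _ hr hmt hmx em) as hmass.
assert (hru : is_derive (fun y => rho (V y) * vel (V y)) xi
                (r' * vel (V xi) + rho (V xi) * u')).
{ apply (is_derive_mult (fun y => rho (V y)) (fun y => vel (V y))); try assumption.
  intros; apply Rmult_comm. }
pose proof (self_similar_balance (fun y => rho (V y) * vel (V y))
  (fun y => rho (V y) * vel (V y) ^ 2 + press E (V y)) _ _ _ _ hru hnt hnx en) as hmom.
(* The derivative of the pressure is that of the momentum flux minus that of
   [rho u^2], both of which are known to exist. *)
assert (hruu : is_derive (fun y => rho (V y) * vel (V y) * vel (V y)) xi
   ((r' * vel (V xi) + rho (V xi) * u') * vel (V xi) + rho (V xi) * vel (V xi) * u')).
{ apply (is_derive_mult (fun y => rho (V y) * vel (V y)) (fun y => vel (V y)));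
  try assumption. intros; apply Rmult_comm. }
assert (hp : is_derive (fun y => rho (V y) * vel (V y) ^ 2 + press E (V y)
                                 - rho (V y) * vel (V y) * vel (V y)) xi
   (xi * (r' * vel (V xi) + rho (V xi) * u')
    - ((r' * vel (V xi) + rho (V xi) * u') * vel (V xi) + rho (V xi) * vel (V xi) * u')))
  by exact (is_derive_minus _ _ _ _ _ hmom hruu).
assert (speed : forall y, bL < y < bS -> csound E (V y) = vel (V y) - y).
{ intros y hy. pose proof (cr_speed _ _ _ _ _ hcr y). lra. }
assert (near : locally xi (fun y => bL < y < bS)).
{ apply filter_and; [now apply open_gt|now apply open_lt]. }
assert (hcs : is_derive (fun y => csound E (V y)) xi (u' - 1)).
{ apply (is_derive_ext_loc (fun y => vel (V y) - y)).
  - apply (filter_imp (fun y => bL < y < bS)); [|exact near].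
    intros y hy. now rewrite speed.
  - apply (is_derive_minus (fun y => vel (V y)) (fun y => y)); [exact hu|].
    exact (is_derive_id xi). }
assert (adm : forall y, bL < y < bS -> eos_dom E (rho (V y)) (ent (V y))).
{ intros y hy. apply (cr_admissible _ _ _ _ _ hcr). lra. }
assert (hgl : is_derive (fun y => csound E (V y) * csound E (V y) * rho (V y)) xi
  (((u' - 1) * csound E (V xi) + csound E (V xi) * (u' - 1)) * rho (V xi)
   + csound E (V xi) * csound E (V xi) * r')).
{ apply (is_derive_mult (fun y => csound E (V y) * csound E (V y)) (fun y => rho (V y))).
  - apply (is_derive_mult (fun y => csound E (V y)) (fun y => csound E (V y)));
    try assumption. intros; apply Rmult_comm.
  - exact hr.
  - intros; apply Rmult_comm. }
assert (hgp : is_derive (fun y => gamma * (rho (V y) * vel (V y) ^ 2 + press E (V y)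
                                 - rho (V y) * vel (V y) * vel (V y))) xi
   (gamma * (xi * (r' * vel (V xi) + rho (V xi) * u')
    - ((r' * vel (V xi) + rho (V xi) * u') * vel (V xi) + rho (V xi) * vel (V xi) * u'))))
  by exact (is_derive_scal _ _ gamma _ hp).
(* [gamma p] is [c^2 rho] in the wave, hence has the derivative found in [hgl]. *)
assert (hgr : is_derive (fun y => gamma * (rho (V y) * vel (V y) ^ 2 + press E (V y)
                                 - rho (V y) * vel (V y) * vel (V y))) xi
  (((u' - 1) * csound E (V xi) + csound E (V xi) * (u' - 1)) * rho (V xi)
   + csound E (V xi) * csound E (V xi) * r')).
{ refine (is_derive_ext_loc _ _ _ _ _ hgl).
  apply (filter_imp (fun y => bL < y < bS)); [|exact near].
  intros y hy. pose proof (polytropic_sound E gamma hE hpoly _ _ (adm y hy)) as h.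
  unfold csound, press. lra. }
assert (eg := is_derive_value_unique _ _ _ _ hgp hgr).
assert (em' := is_derive_value_unique _ _ _ _ hmass hru).
assert (hrpos : 0 < rho (V xi)) by exact (eos_no_vacuum E hE _ _ (adm xi hxi)).
assert (hcpos : 0 < csound E (V xi)) by exact (eos_sound_pos E hE _ _ (adm xi hxi)).
assert (ec := speed xi hxi).
set (c := csound E (V xi)) in *. set (rh := rho (V xi)) in *.
replace (vel (V xi)) with (xi + c) in * by lra.
replace (- mu2 gamma) with (u' - 1); [exact hcs|].
assert (e1 : rh * u' = - (c * r')) by lra.
assert (e2 : c * (2 * rh * (u' - 1) + (gamma - 1) * (rh * u')) = 0).
{ pose proof (f_equal (Rmult c) e1). pose proof (f_equal (Rmult (gamma * c)) e1).
  pose proof (f_equal (Rmult (gamma * xi)) e1). lra. }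
assert (e3 : 2 * (u' - 1) + (gamma - 1) * u' = 0).
{ apply Rmult_eq_reg_l with (c * rh); [|nra]. lra. }
unfold mu2. apply Rmult_eq_reg_r with (gamma + 1); [|lra].
field_simplify; lra.
Qed.

(** In the wave [c = u - xi], so that the continuity of the velocity suffices. *)
Lemma centered_sound_continuous (E : eos) (UL : state) (bL bS : R) (V : R -> state) :
  centered_rarefaction E UL bL bS V ->
  continuous_on1 (Icc bL bS) (fun b => csound E (V b)).
Proof.
intros hcr b hb.
assert (speed : forall y, Icc bL bS y -> csound E (V y) = vel (V y) - y).
{ intros y hy. pose proof (cr_speed _ _ _ _ _ hcr y hy). lra. }
rewrite speed by exact hb.
apply (filterlim_within_ext _ (fun y => vel (V y) + - y)).
- intros y hy. now rewrite speed.
- apply filterlim_Rplus; [typeclasses eauto| |].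
  + exact (proj1 (proj2 (cr_continuous _ _ _ _ _ hcr b hb))).
  + apply filterlim_Ropp. apply (filterlim_filter_le_1 _ (filter_le_within (F := locally b) _)).
    apply filterlim_id.
Qed.

Lemma centered_polytropic_sound (E : eos) (UL : state) (bL bS gamma : R) (V : R -> state) :
  is_eos E -> polytropic E gamma -> 1 < gamma ->
  centered_rarefaction E UL bL bS V ->
  forall b, Icc bL bS b -> csound E (V b) = csound E UL - mu2 gamma * (b - bL).
Proof.
intros hE hpoly hgam hcr b hb.
rewrite <- (cr_left _ _ _ _ _ hcr bL (Rle_refl bL)).
destruct (mvt_closed bL bS (fun b => csound E (V b)) (fun _ => - mu2 gamma) bL b)
  as [c [_ e]].
- exact (centered_sound_continuous E UL bL bS V hcr).
- now apply (centered_polytropic_slope E UL bL bS gamma V).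
- unfold Icc in *; lra.
- exact hb.
- simpl in e. lra.
Qed.

(** [- (1 / (2 m)) ln c] is a primitive of [1 / (2 c)] when [c] has slope [- m]. *)
Lemma Pi_factor_affine (c : R -> R) (m b bL : R) :
  bL <= b -> m <> 0 ->
  (forall y, Icc bL b y -> 0 < c y /\ c y = c bL - m * (y - bL)) ->
  Pi_factor c b bL = Rpower (c b / c bL) (- (1 / (2 * m))).
Proof.
intros hb hm hc.
assert (hcb : 0 < c b) by (apply hc; unfold Icc; lra).
assert (hcL : 0 < c bL) by (apply hc; unfold Icc; lra).
unfold Pi_factor, Rpower. f_equal.
set (k y := c bL - m * (y - bL)).
set (F y := - (1 / (2 * m)) * ln (k y)).
assert (hk : forall y, Icc bL b y -> 0 < k y).
{ intros y hy. unfold k. destruct (hc y hy). lra. }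
replace (- (1 / (2 * m)) * ln (c b / c bL)) with (F b - F bL).
2: { unfold F, Rdiv. rewrite ln_mult, ln_Rinv by (try apply Rinv_0_lt_compat; assumption).
     replace (k b) with (c b) by (apply hc; unfold Icc; lra).
     replace (k bL) with (c bL) by (unfold k; ring). ring. }
apply is_RInt_unique.
apply (is_RInt_ext (fun y => 1 / (2 * k y))).
- rewrite Rmin_left, Rmax_right by exact hb. intros y hy.
  unfold k. rewrite (proj2 (hc y ltac:(unfold Icc; lra))). reflexivity.
- apply (is_RInt_derive F).
  + rewrite Rmin_left, Rmax_right by exact hb. intros y hy.
    specialize (hk y hy). unfold F, k in *.
    auto_derive; [exact hk|]. field. lra.
  + rewrite Rmin_left, Rmax_right by exact hb. intros y hy.
    specialize (hk y hy). apply (ex_derive_continuous (fun y => 1 / (2 * k y))).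
    unfold k in *. auto_derive. lra.
Qed.

(** * The curved rarefaction wave *)

Theorem proposition3p1
  (E : eos) (hE : is_eos E)
  (G : source) (hG : entropy_preserving E G)
  (r tau : R) (wl wr : R -> state)
  (n : nat) (hn : (2 <= n)%nat) (X : nat -> R -> R) (w : R -> R -> state)
  (hgrp : grp_solution E G r tau wl wr n X w)
  (V : R -> state) (hV : riemann_solution E (wl 0) (wr 0) V)
  (hrays : tends_along_rays w V)
  (bL bS : R) (hcr : centered_rarefaction E (wl 0) bL bS V)
  (a1 : R) (x t : R -> R -> R) (fl : R -> R -> state)
  (hrw : curved_rarefaction E r tau (X 0%nat) (X 1%nat) w V a1 bL bS x t fl)
  (Theta : R -> R)
  (hTheta : forall b, bL <= b <= bS ->
     partial1 (char_rect a1 bL bS) t 0 b (Theta b))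
  (hTheta0 : forall b, bL <= b <= bS -> Theta b <> 0) :
  (forall b, bL <= b <= bS ->
     Theta b / Theta bL = Pi_factor (fun xi => csound E (fl 0 xi)) b bL)
  /\
  (forall gamma, 1 < gamma -> polytropic E gamma ->
     forall b, bL <= b <= bS ->
       Theta b / Theta bL
       = Rpower (csound E (fl 0 b) / csound E (wl 0)) (- (1 / (2 * mu2 gamma)))).
Proof.
pose proof (cr_nonempty _ _ _ _ _ hcr) as hLS.
set (p := Rmin 0 a1). set (q := Rmax 0 a1).
assert (h0 : Icc p q 0) by (split; [apply Rmin_l|apply Rmax_l]).
assert (hpq : p < q).
{ pose proof (rw_nondegenerate _ _ _ _ _ _ _ _ _ _ _ _ _ hrw).
  unfold p, q, Rmin, Rmax. destruct Rle_dec; lra. }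
assert (origin : forall b, Icc bL bS b -> csound E (fl 0 b) = csound E (V b)).
{ intros b hb. now apply (rw_origin _ _ _ _ _ _ _ _ _ _ _ _ _ hrw). }
assert (cpos : forall b, Icc bL bS b -> 0 < csound E (fl 0 b)).
{ intros b hb. apply (eos_sound_pos E hE).
  exact (rw_flow_admissible _ _ _ _ _ _ _ _ _ _ _ _ _ hrw 0 b (conj h0 hb)). }
assert (dTheta : forall b, Icc bL bS b -> is_deriv_within (Icc bL bS) Theta b
                   (1 / (2 * csound E (fl 0 b)) * Theta b)).
{ destruct (rw_position_smooth _ _ _ _ _ _ _ _ _ _ _ _ _ hrw) as [Cx Ct].
  apply (singular_transport p q bL bS x t (fun a b => vel (fl a b))
           (fun a b => csound E (fl a b))); try assumption.
  - exact (rw_singular_point _ _ _ _ _ _ _ _ _ _ _ _ _ hrw).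
  - exact (rw_characteristics _ _ _ _ _ _ _ _ _ _ _ _ _ hrw).
  - exact (rw_normalized _ _ _ _ _ _ _ _ _ _ _ _ _ hrw).
  - intros b hb.
    destruct (rw_flow_smooth _ _ _ _ _ _ _ _ _ _ _ _ _ hrw) as [_ [[v1 [v2 [gv _]]] _]].
    apply (is_deriv_within_continuous _ (fun a => vel (fl a b)) 0 (v1 0 b)).
    apply (partial1_rect p q bL bS (fun a b => vel (fl a b))); [exact hb|].
    exact (proj1 (gv 0 b (conj h0 hb))).
  - intros b hb. specialize (cpos b hb). lra. }
(* Continuity in [b] is inherited from the centered wave, which has the same sound
   speed at the origin. *)
assert (chc : continuous_on1 (Icc bL bS) (fun b => 1 / (2 * csound E (fl 0 b)))).
{ intros b hb.
  rewrite origin by exact hb.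
  apply (filterlim_within_ext _ (fun b => 1 / (2 * csound E (V b)))).
  { intros y hy. now rewrite origin. }
  apply (filterlim_comp _ _ _ (fun b => csound E (V b)) (fun z => 1 / (2 * z)) _
           (locally (csound E (V b)))).
  - exact (centered_sound_continuous _ _ _ _ _ hcr b hb).
  - apply (ex_derive_continuous (fun z => 1 / (2 * z))).
    specialize (cpos b hb). rewrite origin in cpos by exact hb.
    auto_derive. lra. }
assert (main : forall b, bL <= b <= bS ->
  Theta b / Theta bL = Pi_factor (fun xi => csound E (fl 0 xi)) b bL).
{ intros b hb.
  assert (hbL : Theta bL <> 0) by (apply hTheta0; lra).
  rewrite (linear_ode bL bS (fun b => 1 / (2 * csound E (fl 0 b))) Theta); try assumption.
  - unfold Pi_factor. now field.
  - intros y hy. exact (is_deriv_within_continuous _ _ _ _ (dTheta y hy)).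
  - intros y hy. apply (is_deriv_within_interior (Icc bL bS)).
    + now apply locally_Icc.
    + apply dTheta. unfold Icc. lra. }
split; [exact main|].
intros gamma hgam hpoly b hb.
rewrite main by exact hb.
assert (hcL : csound E (wl 0) = csound E (fl 0 bL)).
{ rewrite origin by (unfold Icc; lra).
  now rewrite (cr_left _ _ _ _ _ hcr bL (Rle_refl bL)). }
rewrite hcL.
apply (Pi_factor_affine (fun xi => csound E (fl 0 xi))); [apply hb| |].
- unfold mu2. apply Rmult_integral_contrapositive_currified; [lra|].
  apply Rinv_neq_0_compat. lra.
- intros y hy. assert (hy' : Icc bL bS y) by (unfold Icc in *; lra).
  split; [now apply cpos|].
  rewrite <- hcL, (origin y hy').
  now apply (centered_polytropic_sound E (wl 0) bL bS gamma V).
Qed.
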